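(* Let $\alpha\in\mathbb{D}$, let $\rho=\sqrt{1-|\alpha|^2}$, and let $\mu_\alpha$ be the probability measure on the unit circle all of whose Verblunsky coefficients equal $\alpha$. Then for every $n\in\mathbb{N}_0$, \[ \varphi_n(z;\mu_{\alpha})=z^{n/2}\left(U_n\left(\frac{z+1}{2\rho\sqrt{z}}\right)-\frac{1+\bar{\alpha}}{\rho\sqrt{z}}\,U_{n-1}\left(\frac{z+1}{2\rho\sqrt{z}}\right)\right), \] \[ \varphi_n^*(z;\mu_{\alpha})=z^{n/2}\left(U_n\left(\frac{z+1}{2\rho\sqrt{z}}\right)-\frac{\sqrt{z}\,(1+\alpha)}{\rho}\,U_{n-1}\left(\frac{z+1}{2\rho\sqrt{z}}\right)\right), \] where $U_{-1}=0$.
   Context: $\mathbb{D}$ is the open unit disk in $\mathbb{C}$ and $\mathbb{N}_0=\{0,1,2,\dots\}$. For a probability measure $\mu$ with infinite support on the unit circle $\partial\mathbb{D}$, $\Phi_n(z;\mu)$ is the monic orthogonal polynomial of degree $n$ in $L^2(\mu)$ and $\varphi_n(z;\mu)$ is the orthonormal polynomial of degree $n$ (with positive leading coefficient). For a polynomial $P$ indexed by degree $n$, $P^*(z)=z^n\overline{P(1/\bar z)}$; in particular $\Phi_n^*(z;\mu)=z^n\overline{\Phi_n(1/\bar z;\mu)}$ and $\varphi_n^*(z;\mu)=z^n\overline{\varphi_n(1/\bar z;\mu)}$. The Verblunsky coefficients of $\mu$ are the unique numbers $\alpha_n\in\mathbb{D}$ ($n\in\mathbb{N}_0$) such that $\Phi_{n+1}(z;\mu)=z\Phi_n(z;\mu)-\bar\alpha_n\Phi_n^*(z;\mu)$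 for all $n\in\mathbb{N}_0$; the correspondence between infinitely supported probability measures on $\partial\mathbb{D}$ and sequences in $\mathbb{D}^{\mathbb{N}_0}$ is a bijection. $U_n$ is the Chebyshev polynomial of the second kind, $U_n(x)=\sum_{j=0}^{\lfloor n/2\rfloor}(-1)^j\binom{n-j}{j}(2x)^{n-2j}$. The formulas hold for any choice of $\sqrt z$ (the same choice being used throughout each formula), with $z^{n/2}=(\sqrt z)^n$; the right-hand sides are polynomials in $z$, and at $z=0$ they are understood by continuity. *)

(* Defs.v *)
From HB Require Import structures.
From mathcomp Require Import all_boot all_order all_algebra complex.
From mathcomp Require Import all_classical all_reals all_analysis.
Set Implicit Arguments.
Unset Strict Implicit.
Unset Printing Implicit Defensive.
Import Order.TTheory GRing.Theory Num.Theory.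
Import numFieldNormedType.Exports.
Local Open Scope classical_set_scope.
Local Open Scope ring_scope.

Definition circle_pt (R : realType) : Type := {z : R[i]%C | `|z| == 1}.

HB.instance Definition _ (R : realType) := Choice.on (circle_pt R).

Definition circle_one (R : realType) : circle_pt R :=
  exist _ (1 : R[i]%C) (introT eqP (normr1 _)).

HB.instance Definition _ (R : realType) :=
  isPointed.Build (circle_pt R) (circle_one R).

Definition circle_coords (R : realType) (w : circle_pt R) : R * R :=
  (complex.Re (val w), complex.Im (val w)).

(* The circle with the trace of the Borel sigma-algebra of the plane R * R,
   i.e. with its own Borel sigma-algebra. *)
Definition circle (R : realType) := g_sigma_algebra_preimageType (@circle_coords R).

Definition circle_val (R : realType) (w : circle R) : R[i]%C :=
  val (w : circle_pt R).

Definition circle_support (R : realType) (mu : set (circle R) -> \bar R) :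
    set (circle R) :=
  [set w : circle R | forall e : R, 0 < e ->
     (0 < mu [set v : circle R | (`|circle_val v - circle_val w| < e%:C%C)%R])%E].

Definition Cintegral (R : realType) (mu : {measure set (circle R) -> \bar R})
    (f : circle R -> R[i]%C) : R[i]%C :=
  (Rintegral mu setT (fun w => complex.Re (f w)) +i*
   Rintegral mu setT (fun w => complex.Im (f w)))%C.

Definition inner (R : realType) (mu : {measure set (circle R) -> \bar R})
    (P Q : {poly R[i]%C}) : R[i]%C :=
  Cintegral mu (fun w => (P.[circle_val w])^* * Q.[circle_val w]).

Definition is_monic_op (R : realType) (mu : {measure set (circle R) -> \bar R})
    (n : nat) (P : {poly R[i]%C}) : Prop :=
  [/\ P \is monic, size P = n.+1 &
      forall Q : {poly R[i]%C}, (size Q <= n)%N -> inner mu Q P = 0].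

(* In R[i], [0 < x] means that x is real and positive. *)
Definition is_orthonormal_op (R : realType)
    (mu : {measure set (circle R) -> \bar R})
    (n : nat) (P : {poly R[i]%C}) : Prop :=
  [/\ 0 < lead_coef P, size P = n.+1, inner mu P P = 1 &
      forall Q : {poly R[i]%C}, (size Q <= n)%N -> inner mu Q P = 0].

(* If mu has infinite support, exactly one polynomial satisfies each of the two
   predicates above, and xget picks it. *)
Definition monic_op (R : realType) (mu : {measure set (circle R) -> \bar R})
    (n : nat) : {poly R[i]%C} := xget 0 [set P | is_monic_op mu n P].

Definition orthonormal_op (R : realType)
    (mu : {measure set (circle R) -> \bar R})
    (n : nat) : {poly R[i]%C} := xget 0 [set P | is_orthonormal_op mu n P].

(* The polynomial z^n * (P (1 / z^* ))^*; see reversedE. *)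
Definition reversed (K : numClosedFieldType) (n : nat) (P : {poly K}) :
    {poly K} := \poly_(i < n.+1) (P`_(n - i))^*.

Lemma reversedE (K : numClosedFieldType) (n : nat) (P : {poly K}) (z : K) :
  (size P <= n.+1)%N -> z != 0 ->
  (reversed n P).[z] = z ^+ n * (P.[(z^*)^-1])^*.
Proof.
move=> sP z0.
rewrite horner_poly (horner_coef_wide _ sP) rmorph_sum mulr_sumr /=.
rewrite (reindex_inj rev_ord_inj) /=; apply: eq_bigr => i _.
have lein : (i <= n)%N by rewrite -ltnS.
rewrite subSS subKn // rmorphM /= rmorphXn /= fmorphV /=.
rewrite conjCK mulrCA; congr (_ * _).
by rewrite exprVn expfB_cond ?(negPf z0) ?add0n.
Qed.

Definition verblunsky_coefficients (R : realType)
    (mu : {measure set (circle R) -> \bar R}) (a : nat -> R[i]%C) : Prop :=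
  forall n, `|a n| < 1 /\
    monic_op mu n.+1 =
      'X * monic_op mu n - ((a n)^*)%:P * reversed n (monic_op mu n).

Definition chebyU (K : fieldType) (n : nat) : {poly K} :=
  \sum_(j < (n./2).+1)
    ((-1) ^+ j * 'C(n - j, j)%:R) *: (2%:R *: 'X) ^+ (n - j.*2).

(* U_(n-1), with U_(-1) = 0. *)
Definition chebyU_pred (K : fieldType) (n : nat) : {poly K} :=
  if n is m.+1 then chebyU K m else 0.

(* f z = G z (sqrt z) for every nonzero z and every choice of the square root s
   of z; at z = 0 the right-hand side is taken as its limit when z = s^2 tends
   to 0. *)
Definition eq_for_sqrt (K : numFieldType) (f : K -> K) (G : K -> K -> K) :
    Prop :=
  (forall z s : K, z != 0 -> s ^+ 2 = z -> f z = G z s) /\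
  G (s ^+ 2) s @[s --> (0 : K)^'] --> f 0.

(* Main.v *)
(* The recurrence forces every [monic_op mu n] to be monic, hence nonzero, hence a
   genuine orthogonal polynomial, with squared norms multiplied by
   [1 - `|alpha| ^+ 2 = rho ^+ 2] at each step.  So the orthonormal polynomial is
   [rho ^- n *: monic_op mu n], and it satisfies with its reversal the normalised
   Szego recurrence
     [rho phi_(n+1) = z phi_n - alpha^* phi_n^*],
     [rho phi_(n+1)^* = phi_n^* - alpha z phi_n].
   By U_(n+1) = 2 x U_n - U_(n-1), the Chebyshev expressions solve it too. *)
Require Import Defs.
From mathcomp Require Import all_boot all_order all_algebra complex.
From mathcomp Require Import all_classical all_reals all_analysis.
From mathcomp Require Import measurable_realfun ring zify.
Import Order.TTheory GRing.Theory Num.Theory.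
Import numFieldNormedType.Exports.
Local Open Scope classical_set_scope.
Local Open Scope ring_scope.

(** * Three-term recurrence of the Chebyshev polynomials *)

(** For [n./2 < j] the truncated difference [n - j] is less than [j], so the binomial coefficient
    vanishes. A free upper bound lets sums of different degrees share an index range. *)
Lemma chebyU_wide (K : fieldType) (n m : nat) : (n./2 < m)%N ->
  chebyU K n = \sum_(j < m)
    ((-1) ^+ j * 'C(n - j, j)%:R) *: (2%:R *: 'X) ^+ (n - j.*2).
Proof.
move=> nm; rewrite /chebyU.
rewrite (big_ord_widen m
  (fun j => ((-1) ^+ j * 'C(n - j, j)%:R) *: (2%:R *: 'X) ^+ (n - j.*2))) //.
rewrite big_mkcond; apply: eq_bigr => j _.
by case: ifPn => // jn; rewrite bin_small ?mulr0 ?scale0r //; lia.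
Qed.

(** Pascal's rule: once the term of index 0 is split off, ['C(n.+1 - j, j.+1)] is
    ['C(n - j, j.+1) + 'C(n - j, j)]; the first summand belongs to [2 X U_(n+1)], the second to
    [- U_n]. *)
Lemma chebyUSS (K : fieldType) (n : nat) :
  chebyU K n.+2 = (2%:R *: 'X) * chebyU K n.+1 - chebyU K n.
Proof.
rewrite (@chebyU_wide K n.+2 n.+2); last by lia.
rewrite (@chebyU_wide K n.+1 n.+2); last by lia.
rewrite (@chebyU_wide K n n.+1); last by lia.
rewrite !(big_ord_recl n.+1) mulrDr -addrA; congr (_ + _).
  by rewrite !subn0 !bin0 !expr0 !mulr1 !scale1r -exprS.
rewrite mulr_sumr -sumrB; apply: eq_bigr => j _.
rewrite !lift0 doubleS !subSS.
have jn : (j <= n)%N by rewrite -ltnS.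
rewrite subSn // binS natrD mulrDr scalerDl; congr (_ + _); last first.
  by rewrite exprS mulN1r mulNr scaleNr.
(* For [n <= 2j] the truncated exponents disagree, but then ['C(n - j, j.+1)] is 0. *)
rewrite -scalerAr -exprS; case: (leqP j.*2.+1 n) => jn2.
  by congr (_ *: _ ^+ _); lia.
by rewrite bin_small ?mulr0 ?scale0r //; lia.
Qed.

Lemma chebyU0 (K : fieldType) : chebyU K 0 = 1.
Proof. by rewrite /chebyU big_ord1 bin0 !expr0 mulr1 scale1r. Qed.

Lemma chebyU1 (K : fieldType) : chebyU K 1 = 2%:R *: 'X.
Proof. by rewrite /chebyU big_ord1 bin0 expr0 mulr1 scale1r. Qed.

Lemma chebyU_predS (K : fieldType) (n : nat) :
  chebyU K n.+1 = (2%:R *: 'X) * chebyU K n - chebyU_pred K n.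
Proof.
by case: n => [|n]; rewrite ?chebyUSS // chebyU0 chebyU1 mulr1 subr0.
Qed.

(** * Chebyshev solution of the normalised Szego recurrence *)

(** Pure algebra at a fixed point: [a'] stands for the conjugate of [a], and [f], [g] for the values
    at [z] of the orthonormal polynomials and their reversals. The induction carries both formulas
    because each recurrence mixes the two sequences. *)
Lemma szego_chebyshev (K : numFieldType) (a a' rho : K) (f g : nat -> K) (z s : K) :
  rho != 0 -> rho ^+ 2 = 1 - a' * a -> s != 0 -> s ^+ 2 = z ->
  f 0 = 1 -> g 0 = 1 ->
  (forall n, f n.+1 = rho^-1 * (z * f n - a' * g n)) ->
  (forall n, g n.+1 = rho^-1 * (g n - a * (z * f n))) ->
  forall n : nat, let x := (z + 1) / (2%:R * rho * s) in
  f n = s ^+ n * ((chebyU K n).[x] - (1 + a') / (rho * s) * (chebyU_pred K n).[x])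
  /\
  g n = s ^+ n * ((chebyU K n).[x] - s * (1 + a) / rho * (chebyU_pred K n).[x]).
Proof.
move=> rho0 rho2 s0 s2 f0 g0 fS gS n x.
elim: n => [|n [IHf IHg]].
  by rewrite f0 g0 chebyU0 /= !hornerC !mulr0 !subr0 mulr1.
rewrite fS gS IHf IHg chebyU_predS /= hornerD hornerM hornerN hornerZ hornerX.
rewrite -s2 (exprS s n).
have -> : 2%:R * x = (s ^+ 2 + 1) / (rho * s).
  by rewrite /x -s2; field; rewrite rho0 s0.
move: (s ^+ n) (chebyU K n).[x] (chebyU_pred K n).[x] => c u v.
(* In both halves, after multiplication by [rho ^+ 2], the terms in [u] cancel and the difference of
   the sides is a multiple of the relation [rho ^+ 2 = 1 - a' * a]. *)
split.
- apply: (mulfI (mulf_neq0 rho0 rho0)); apply/eqP; rewrite -subr_eq0; apply/eqP.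
  rewrite [LHS](_ : _ = c * s * v * (rho ^+ 2 - (1 - a' * a)));
    last by field; rewrite rho0 s0.
  by rewrite rho2; ring.
- apply: (mulfI (mulf_neq0 rho0 rho0)); apply/eqP; rewrite -subr_eq0; apply/eqP.
  rewrite [LHS](_ : _ = c * s * v * (rho ^+ 2 - (1 - a' * a)));
    last by field; rewrite rho0 s0.
  by rewrite rho2; ring.
Qed.

(** * Continuity of polynomials and the limit at 0 *)

Lemma continuous_poly (K : numFieldType) (p : {poly K}) : continuous (horner p).
Proof.
elim/poly_ind: p => [|p c IH] x.
  rewrite (_ : horner 0 = (cst 0)); first exact: cst_continuous.
  by apply/funext => y; rewrite horner0.
have -> : horner (p * 'X + c%:P) = ((horner p \* id) \+ cst c).
  by apply/funext => y; rewrite hornerMXaddC.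
have cM : {for x, continuous (horner p \* id)}.
  by apply: continuousM; [exact: IH|exact: cvg_id].
exact: (continuousD cM (@cst_continuous K K c x)).
Qed.

(** The limit clause follows from the pointwise one: on a punctured neighbourhood of 0,
    [G (s ^+ 2) s] equals [p.[s ^+ 2]], a polynomial in [s] and hence continuous. *)
Lemma eq_for_sqrt_poly (K : numFieldType) (p : {poly K}) (G : K -> K -> K) :
  (forall z s : K, z != 0 -> s ^+ 2 = z -> p.[z] = G z s) ->
  eq_for_sqrt (fun z => p.[z]) G.
Proof.
move=> pG; split=> //.
have pc : p.[s ^+ 2] @[s --> (0 : K)^'] --> p.[0].
  apply: cvg_within_filter.
  have -> : p.[0] = (p \Po 'X^2).[0] by rewrite horner_comp hornerXn expr0n.
  rewrite (_ : (fun s => p.[s ^+ 2]) = horner (p \Po 'X^2)).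
    exact: continuous_poly.
  by apply/funext => s; rewrite horner_comp hornerXn.
apply: cvg_trans pc; apply: near_eq_cvg; near=> s.
by apply: pG => //; rewrite sqrf_eq0; near: s; exact: nbhs_dnbhs_neq.
Unshelve. all: by end_near.
Qed.

(** * Bounded measurable complex functions on the circle *)

Section Inner.
Context {R : realType}.

Lemma measurable_circle_coords :
  measurable_fun [set: circle R] (@circle_coords R).
Proof. by move=> _ Y mY; rewrite setTI; exists Y => //; rewrite setTI. Qed.

(** A class closed under sums, products and conjugation that contains [circle_val], hence every
    integrand of [inner]; its members are integrable for a probability measure. Real and imaginary
    parts are kept apart, as in [Cintegral]. *)
Definition bounded_measurable (f : circle R -> R[i]) : Prop :=
  [/\ measurable_fun [set: circle R] (fun w => complex.Re (f w) : R),
      measurable_fun [set: circle R] (fun w => complex.Im (f w) : R) &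
      exists M : R, forall w, `|complex.Re (f w)| <= M /\ `|complex.Im (f w)| <= M].

Lemma bounded_measurable_cst c : bounded_measurable (fun=> c).
Proof.
split; [exact: measurable_cst|exact: measurable_cst|].
exists (Num.max `|complex.Re c| `|complex.Im c|) => w.
by rewrite !le_max !lexx orbT.
Qed.

(** The sigma-algebra is generated by the two coordinates, and these are at most 1 in absolute value
    on the unit circle. *)
Lemma bounded_measurable_circle_val : bounded_measurable (@circle_val R).
Proof.
split.
- exact: (measurableT_comp measurable_fst measurable_circle_coords).
- exact: (measurableT_comp measurable_snd measurable_circle_coords).
exists 1 => -[[a b] /= ab1]; rewrite /circle_val /=.
have : a ^+ 2 + b ^+ 2 = 1.
  move/eqP: ab1 => /(congr1 (fun z => z ^+ 2)); rewrite sqr_normc expr1n.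
  rewrite /= => -[ + _]; rewrite -!expr2 => <-; ring.
have norm_le1 (x : R) : x ^+ 2 <= 1 -> `|x| <= 1.
  by rewrite -(real_normK (num_real x)) expr_le1.
by move=> ab; split; apply: norm_le1; rewrite -ab ?lerDl ?lerDr sqr_ge0.
Qed.

Lemma bounded_measurableD f g :
  bounded_measurable f -> bounded_measurable g ->
  bounded_measurable (fun w => f w + g w).
Proof.
move=> [rf jf [M fM]] [rg jg [N gN]]; split.
- rewrite (_ : (fun w => _) = (fun w => complex.Re (f w) + complex.Re (g w))).
    exact: measurable_funD.
  by apply/funext => w; rewrite raddfD.
- rewrite (_ : (fun w => _) = (fun w => complex.Im (f w) + complex.Im (g w))).
    exact: measurable_funD.
  by apply/funext => w; rewrite raddfD.
exists (M + N) => w; rewrite !raddfD /=.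
have [? ?] := fM w; have [? ?] := gN w.
by split; apply: (le_trans (ler_normD _ _)); exact: lerD.
Qed.

Lemma bounded_measurableM f g :
  bounded_measurable f -> bounded_measurable g ->
  bounded_measurable (fun w => f w * g w).
Proof.
move=> [rf jf [M fM]] [rg jg [N gN]]; split.
- rewrite (_ : (fun w => _) = (fun w => complex.Re (f w) * complex.Re (g w) -
     complex.Im (f w) * complex.Im (g w))).
    by apply: measurable_funB; exact: measurable_funM.
  by apply/funext => w; case: (f w) (g w) => [a b] [c d].
- rewrite (_ : (fun w => _) = (fun w => complex.Re (f w) * complex.Im (g w) +
     complex.Im (f w) * complex.Re (g w))).
    by apply: measurable_funD; exact: measurable_funM.
  by apply/funext => w; case: (f w) (g w) => [a b] [c d].
exists (M * N + M * N) => w.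
have [] := fM w; have [] := gN w; case: (f w) (g w) => [a b] [c d] /= *.
by split; [apply: (le_trans (ler_normB _ _))|apply: (le_trans (ler_normD _ _))];
  apply: lerD; rewrite normrM ler_pM.
Qed.

Lemma bounded_measurable_conj f :
  bounded_measurable f -> bounded_measurable (fun w => (f w)^*).
Proof.
move=> [rf jf [M fM]]; split.
- rewrite (_ : (fun w => _) = (fun w => complex.Re (f w))) //.
  by apply/funext => w; case: (f w).
- rewrite (_ : (fun w => _) = (fun w => - complex.Im (f w))).
    exact: measurable_funN.
  by apply/funext => w; case: (f w).
by exists M => w; have [] := fM w; case: (f w) => a b /= *; rewrite normrN.
Qed.

Lemma bounded_measurable_horner (P : {poly R[i]}) :
  bounded_measurable (fun w => P.[circle_val w]).
Proof.
elim/poly_ind: P => [|P c IH].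
  by under eq_fun do rewrite horner0; exact: bounded_measurable_cst.
under eq_fun do rewrite hornerMXaddC.
by apply: bounded_measurableD (bounded_measurable_cst c);
  apply: bounded_measurableM bounded_measurable_circle_val.
Qed.

(** * Linearity and conjugation of the complex integral *)

Context (mu : probability (circle R) R).

Lemma integrable_bounded_measurable f : bounded_measurable f ->
  mu.-integrable setT (EFin \o (fun w => complex.Re (f w))) /\
  mu.-integrable setT (EFin \o (fun w => complex.Im (f w))).
Proof.
move=> [rf jf [M fM]].
by split; (apply: measurable_bounded_integrable => //;
  [exact: fin_num_fun_lty|exists M; split; [exact: num_real|move=> N MN w _]]);
  apply/ltW/le_lt_trans/MN; have [] := fM w.
Qed.

Lemma CintegralD f g : bounded_measurable f -> bounded_measurable g ->
  Cintegral mu (fun w => f w + g w) = Cintegral mu f + Cintegral mu g.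
Proof.
move=> /integrable_bounded_measurable[rf jf] /integrable_bounded_measurable[rg jg].
rewrite /Cintegral.
under eq_Rintegral do rewrite raddfD.
rewrite RintegralD //.
under [in X in (_ +i* X)%C]eq_Rintegral do rewrite raddfD.
by rewrite RintegralD.
Qed.

Lemma CintegralZ c f : bounded_measurable f ->
  Cintegral mu (fun w => c * f w) = c * Cintegral mu f.
Proof.
case: c => a b /integrable_bounded_measurable[rf jf].
have ZlR k h : mu.-integrable setT (EFin \o h) ->
    mu.-integrable setT (EFin \o (fun w => k * h w : R)).
  by move=> ih; apply: (integrableZl measurableT k ih).
rewrite /Cintegral.
rewrite (_ : (fun w => complex.Re _) =
  (fun w => a * complex.Re (f w) - b * complex.Im (f w))); last first.
  by apply/funext => w; case: (f w).
rewrite (_ : (fun w => complex.Im _) =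
  (fun w => a * complex.Im (f w) + b * complex.Re (f w))); last first.
  by apply/funext => w; case: (f w).
by rewrite RintegralB ?RintegralD ?RintegralZl //; exact: ZlR.
Qed.

Lemma Cintegral_conj f : bounded_measurable f ->
  Cintegral mu (fun w => (f w)^*) = (Cintegral mu f)^*.
Proof.
move=> /integrable_bounded_measurable[rf jf]; rewrite /Cintegral.
rewrite (_ : (fun w => complex.Re _) = (fun w => complex.Re (f w))); last first.
  by apply/funext => w; case: (f w).
rewrite (_ : (fun w => complex.Im _) = (fun w => -1 * complex.Im (f w))); last first.
  by apply/funext => w; rewrite mulN1r; case: (f w).
by rewrite RintegralZl // mulN1r.
Qed.

(** * The sesquilinear form on polynomials *)

Lemma bounded_measurable_inner (P Q : {poly R[i]}) :
  bounded_measurable (fun w => (P.[circle_val w])^* * Q.[circle_val w]).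
Proof.
by apply: bounded_measurableM; [apply: bounded_measurable_conj|];
  exact: bounded_measurable_horner.
Qed.

Lemma innerDr (P Q S : {poly R[i]}) :
  inner mu P (Q + S) = inner mu P Q + inner mu P S.
Proof.
rewrite /inner -CintegralD; try exact: bounded_measurable_inner.
by congr Cintegral; apply/funext => w; rewrite hornerD mulrDr.
Qed.

Lemma innerZr c (P Q : {poly R[i]}) : inner mu P (c *: Q) = c * inner mu P Q.
Proof.
rewrite /inner -CintegralZ; last exact: bounded_measurable_inner.
by congr Cintegral; apply/funext => w; rewrite hornerZ mulrCA.
Qed.

Lemma inner_conj (P Q : {poly R[i]}) : (inner mu P Q)^* = inner mu Q P.
Proof.
rewrite /inner -Cintegral_conj; last exact: bounded_measurable_inner.
by congr Cintegral; apply/funext => w; rewrite rmorphM /= conjCK mulrC.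
Qed.

Lemma innerDl (P Q S : {poly R[i]}) :
  inner mu (P + Q) S = inner mu P S + inner mu Q S.
Proof. by rewrite -inner_conj innerDr rmorphD /= !inner_conj. Qed.

Lemma innerZl c (P Q : {poly R[i]}) : inner mu (c *: P) Q = c^* * inner mu P Q.
Proof. by rewrite -inner_conj innerZr rmorphM /= inner_conj. Qed.

Lemma inner_ge0 (P : {poly R[i]}) : 0 <= inner mu P P.
Proof.
(* In [R[i]] the inequality also asserts that the value is real. The integrand is [|P|^2], whose
   imaginary part is 0. *)
rewrite /inner /Cintegral lecE /=; apply/andP; split.
  rewrite (_ : (fun w => complex.Im _) = (fun=> 0)).
    by rewrite Rintegral_cst // mul0r.
  apply/funext => w; case: (P.[_]) => a b /=; ring.
apply: Rintegral_ge0 => w _; case: (P.[_]) => a b /=.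
by rewrite mulNr opprK -!expr2 addr_ge0 // sqr_ge0.
Qed.

Lemma inner11 : inner mu 1 1 = 1.
Proof.
rewrite /inner (_ : (fun w => _) = (fun=> 1)); last first.
  by apply/funext => w; rewrite hornerC rmorph1 mulr1.
by rewrite /Cintegral !Rintegral_cst //= probability_setT /= mul0r mulr1.
Qed.

Lemma circle_val_conj (w : circle R) : circle_val w * (circle_val w)^* = 1.
Proof. by rewrite -normCK (eqP (valP (w : circle_pt R))) expr1n. Qed.

(** Multiplication by [z] is an isometry because [|z| = 1] on the circle. *)
Lemma inner_mulX (P Q : {poly R[i]}) : inner mu ('X * P) ('X * Q) = inner mu P Q.
Proof.
congr Cintegral; apply/funext => w; rewrite !hornerM hornerX rmorphM /= mulrACA.
by rewrite (mulrC _ (circle_val w)) circle_val_conj mul1r.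
Qed.

(** On the circle [1 / z^*] is [z], so [reversed n P] takes the value [z^n P(z)^*]; the unimodular
    factors cancel and the conjugation swaps the arguments. *)
Lemma inner_reversed n (P Q : {poly R[i]}) :
  (size P <= n.+1)%N -> (size Q <= n.+1)%N ->
  inner mu (reversed n P) (reversed n Q) = inner mu Q P.
Proof.
move=> sP sQ; congr Cintegral; apply/funext => w.
have wc := circle_val_conj w.
have w0 : circle_val w != 0.
  by apply: contra_eq_neq wc => ->; rewrite mul0r eq_sym oner_eq0.
have wV : ((circle_val w)^*)^-1 = circle_val w.
  by rewrite -[LHS]mul1r -wc mulfK // conjC_eq0.
rewrite !reversedE // wV !rmorphM !rmorphXn /= conjCK mulrACA -exprMn.
by rewrite (mulrC _ (circle_val w)) wc expr1n mul1r mulrC.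
Qed.
End Inner.

(** * Algebra of the reversal *)

Section Reversed.
Context {K : numClosedFieldType}.

Lemma size_reversed n (P : {poly K}) : (size (reversed n P) <= n.+1)%N.
Proof. exact: size_poly. Qed.

Lemma reversedZ n c (P : {poly K}) : reversed n (c *: P) = c^* *: reversed n P.
Proof.
apply/polyP => i; rewrite coefZ !coef_poly; case: ifP => _; last by rewrite mulr0.
by rewrite coefZ rmorphM.
Qed.

Lemma reversed0 : reversed 0 (1 : {poly K}) = 1.
Proof.
by apply/polyP => -[|i]; rewrite coef_poly ?coef1 //= rmorph1.
Qed.

(** Reversal in degree [n.+1] exchanges ['X * P] and [reversed n P] and conjugates scalars. This
    turns the recurrence for the orthogonal polynomials into the one for their reversals. *)
Lemma reversed_szego n a (P : {poly K}) : (size P <= n.+1)%N ->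
  reversed n.+1 ('X * P - (a^*)%:P * reversed n P) =
  reversed n P - a%:P * ('X * P).
Proof.
move=> sP; apply/polyP => i.
rewrite coefB coefCM coefXM !coef_poly coefB coefXM coefCM coef_poly.
rewrite rmorphB rmorphM /= conjCK.
case: i => [|i] /=.
  by rewrite subn0 ltnn /= rmorph0 mulr0 !subr0 subn0.
rewrite subSS ltnS !ltnS.
case: (leqP i n) => [ilen|nlti]; last first.
  by rewrite ltnNge (ltnW nlti) /= nth_default ?mulr0 ?subr0 // (leq_trans sP).
rewrite leq_subr subKn // conjCK; congr (_ - _).
(* At [i = n] both remaining coefficients are 0: ['X * P] has no constant term, and [reversed n P]
   stops at degree [n]. *)
case: (ltnP i n) => [iltn|nlei].
  have -> : (n - i == 0)%N = false by lia.
  by rewrite subnS.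
have -> : (n - i == 0)%N by lia.
by rewrite rmorph0.
Qed.
End Reversed.

(** * Norms and uniqueness of the orthogonal polynomials *)

Section Szego.
Context {R : realType} (mu : probability (circle R) R) (a : nat -> R[i])
  (muV : verblunsky_coefficients mu a).
Local Notation Phi := (monic_op mu).

Lemma monic_op0 : Phi 0 = 1.
Proof.
(* In degree 0 orthogonality only concerns [Q = 0], so 1 qualifies and [xget] does not fall back on
   its default. *)
have op1 : is_monic_op mu 0 1.
  split; rewrite ?monic1 ?size_poly1 // => Q; rewrite leqn0 size_poly_eq0 => /eqP->.
  by rewrite -(scale0r 1) innerZl rmorph0 mul0r.
have [] := xgetPex (0 : {poly R[i]}) (ex_intro _ _ op1).
rewrite -/(Phi 0) => mPhi /eqP/size_poly1P[c _ cE] _.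
by move: mPhi; rewrite cE monicE lead_coefC => /eqP->.
Qed.

(* A degree without a monic orthogonal polynomial would give [Phi n = 0] by the
   default value of [xget]; the recurrence excludes this, since it preserves
   monicity. *)
Lemma monic_opP n : is_monic_op mu n (Phi n).
Proof.
have [mP sP] : Phi n \is monic /\ size (Phi n) = n.+1.
  elim: n => [|n [mP sP]]; first by rewrite monic_op0 monic1 size_poly1.
  have [_ ->] := muV n.
  have sX : size ('X * Phi n) = n.+2.
    by rewrite mulrC size_mulX ?sP // -size_poly_gt0 sP.
  have sR : (size (- ((a n)^*%:P * reversed n (Phi n))) < size ('X * Phi n)%R)%N.
    rewrite sX size_polyN mul_polyC ltnS.
    exact: leq_trans (size_scale_leq _ _) (size_reversed _ _).
  rewrite monicE lead_coefDl // size_polyDl // sX; split=> //.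
  by rewrite -monicE monicMl ?monicX.
have := monic_neq0 mP; rewrite /monic_op.
by case: xgetP => [P -> //|_]; rewrite eqxx.
Qed.

(** Pythagoras for [z Phi_n = Phi_(n+1) + (a n)^* Phi_n^*]: the summands are orthogonal since
    [Phi_n^*] has degree at most [n], while [z Phi_n] and [Phi_n^*] both have the norm of
    [Phi_n]. *)
Lemma inner_monic_opS n :
  inner mu (Phi n.+1) (Phi n.+1) =
  (1 - `|a n| ^+ 2) * inner mu (Phi n) (Phi n).
Proof.
have [_ sP _] := monic_opP n; have [_ _ orth] := monic_opP n.+1.
have e : 'X * Phi n = Phi n.+1 + (a n)^* *: reversed n (Phi n).
  by have [_ ->] := muV n; rewrite -mul_polyC subrK.
have o1 : inner mu (reversed n (Phi n)) (Phi n.+1) = 0.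
  exact/orth/size_reversed.
have o2 : inner mu (Phi n.+1) (reversed n (Phi n)) = 0.
  by rewrite -inner_conj o1 rmorph0.
have := inner_mulX mu (Phi n) (Phi n).
rewrite {1 2}e innerDl !innerDr !innerZl !innerZr o1 o2 inner_reversed ?sP //.
by move=> E; rewrite mulrBl mul1r -[X in X - _]E conjCK normCK; ring.
Qed.

(** The norm of [Phi 0 = 1] is the total mass 1, and each factor [1 - |a n|^2] is positive. *)
Lemma inner_monic_op_gt0 n : 0 < inner mu (Phi n) (Phi n).
Proof.
elim: n => [|n IH]; first by rewrite monic_op0 inner11 ltr01.
rewrite inner_monic_opS mulr_gt0 // subr_gt0 expr_lt1 //.
by have [] := muV n.
Qed.

Lemma monic_op_decomposition n (P : {poly R[i]}) : size P = n.+1 ->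
  exists2 Q : {poly R[i]}, (size Q <= n)%N & P = Q + lead_coef P *: Phi n.
Proof.
move=> sP; have [mPhi sPhi _] := monic_opP n.
exists (P - lead_coef P *: Phi n); last by rewrite subrK.
apply/leq_sizeP => j; rewrite leq_eqVlt => /predU1P[<-|nj].
  have := monicP mPhi; rewrite !lead_coefE sP sPhi /= coefB coefZ => ->.
  by rewrite mulr1 subrr.
by rewrite coefB coefZ !nth_default ?mulr0 ?subr0 // ?sP ?sPhi.
Qed.

(** With [k] the degree of a nonzero [P] and [d] its leading coefficient, [P = Q + d Phi_k] is an
    orthogonal sum, so its squared norm is at least [|d|^2] times that of [Phi_k], which is
    positive. *)
Lemma inner_eq0 (P : {poly R[i]}) : inner mu P P = 0 -> P = 0.
Proof.
case sP : (size P) => [|k]; first by move/eqP: sP; rewrite size_poly_eq0 => /eqP.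
have [_ _ orth] := monic_opP k.
have d0 : lead_coef P != 0 by rewrite lead_coef_eq0 -size_poly_gt0 sP.
have [Q /orth o1] := monic_op_decomposition _ _ sP.
move: (lead_coef P) d0 => d d0 ->.
have o2 : inner mu (Phi k) Q = 0 by rewrite -inner_conj o1 rmorph0.
rewrite innerDl !innerDr !innerZl !innerZr o1 o2 !mulr0 addr0 add0r.
rewrite mulrA (mulrC _^*) -normCK => /eqP; apply: contraTeq => _.
rewrite gt_eqF // ltr_wpDl ?inner_ge0 // mulr_gt0 ?inner_monic_op_gt0 //.
by rewrite exprn_gt0 // normr_gt0.
Qed.

(** [c *: Phi n] is a witness, so [xget] returns a genuine orthonormal polynomial; the rest shows
    that any such polynomial is this one. *)
Lemma orthonormal_opE n (c : R[i]) : 0 < c ->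
  c ^+ 2 * inner mu (Phi n) (Phi n) = 1 -> orthonormal_op mu n = c *: Phi n.
Proof.
move=> c0 cN; have [mPhi sPhi orth] := monic_opP n.
have c_real : c^* = c by rewrite conj_Creal // gtr0_real.
rewrite /orthonormal_op; case: xgetP => [P _ [dP sP nP oP]|noP]; last first.
  exfalso; apply: (noP (c *: Phi n)); split.
  - by rewrite lead_coefZ (monicP mPhi) mulr1.
  - by rewrite size_scale ?gt_eqF.
  - by rewrite innerZl innerZr c_real mulrA -expr2.
  - by move=> Q sQ; rewrite innerZr orth ?mulr0.
have [Q sQ] := monic_op_decomposition _ _ sP.
move: (lead_coef P) dP => d d0 PQ.
(* [Q] has degree below [n], so it is orthogonal to [P] and to [Phi n], hence to itself. *)
have Q0 : Q = 0.
  apply: inner_eq0.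
  have -> : inner mu Q Q = inner mu Q P - d * inner mu Q (Phi n).
    by rewrite PQ innerDr innerZr addrK.
  by rewrite oP // orth // mulr0 subr0.
have Pd : P = d *: Phi n by rewrite PQ Q0 add0r.
rewrite Pd; congr (_ *: _).
move: nP; rewrite Pd innerZl innerZr conj_Creal ?gtr0_real //.
rewrite mulrA -expr2 -cN => /mulIf-/(_ (lt0r_neq0 (inner_monic_op_gt0 n))).
(* Positivity of both leading coefficients selects the root: [d ^+ 2 = c ^+ 2] gives [d = c]. *)
by move/eqP; rewrite eqrXn2 ?ltW // => /eqP.
Qed.
End Szego.

(** * Closed formulas for constant Verblunsky coefficients *)

Theorem theorem3p1 (R : realType) (alpha : R[i]%C)
    (mu : probability (circle R) R) :
  `|alpha| < 1 ->
  infinite_set (circle_support mu) ->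
  verblunsky_coefficients mu (fun _ : nat => alpha) ->
  let rho : R[i]%C := sqrtC (1 - `|alpha| ^+ 2) in
  forall n : nat,
  eq_for_sqrt
    (fun z => (orthonormal_op mu n).[z])
    (fun z s =>
       s ^+ n * ((chebyU _ n).[(z + 1) / (2%:R * rho * s)]
                 - (1 + alpha^*) / (rho * s)
                   * (chebyU_pred _ n).[(z + 1) / (2%:R * rho * s)])) /\
  eq_for_sqrt
    (fun z => (reversed n (orthonormal_op mu n)).[z])
    (fun z s =>
       s ^+ n * ((chebyU _ n).[(z + 1) / (2%:R * rho * s)]
                 - s * (1 + alpha) / rho
                   * (chebyU_pred _ n).[(z + 1) / (2%:R * rho * s)])).
Proof.
move=> alpha1 _ muV rho n.
have rho0 : 0 < rho by rewrite sqrtC_gt0 subr_gt0 expr_lt1.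
have rho2 : rho ^+ 2 = 1 - `|alpha| ^+ 2 by rewrite sqrtCK.
have rho_neq0 := lt0r_neq0 rho0.
(* The squared norm of [monic_op mu k] is [rho ^+ 2] to the power [k], one factor per step of the
   recurrence. *)
have phiE k : orthonormal_op mu k = rho ^- k *: monic_op mu k.
  apply: (orthonormal_opE _ _ muV); first by rewrite invr_gt0 exprn_gt0.
  elim: k => [|k IH].
    by rewrite monic_op0 inner11 expr0 invr1 expr1n mulr1.
  rewrite (inner_monic_opS _ _ muV) -rho2 -[RHS]IH (exprS rho k); field.
  by rewrite rho_neq0 expf_neq0.
(* The normalising factor is real, so it passes unchanged through the conjugation in [reversed]. *)
have rho_real k : (rho ^- k)^* = rho ^- k.
  by rewrite conj_Creal // gtr0_real // invr_gt0 exprn_gt0.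
have phiS k : orthonormal_op mu k.+1 =
    rho^-1 *: ('X * orthonormal_op mu k -
               (alpha^*)%:P * reversed k (orthonormal_op mu k)).
  rewrite !phiE reversedZ rho_real -!scalerAr -scalerBr scalerA.
  by have [_ ->] := muV k; rewrite exprS invfM.
have revS k : reversed k.+1 (orthonormal_op mu k.+1) =
    rho^-1 *: (reversed k (orthonormal_op mu k) -
               alpha%:P * ('X * orthonormal_op mu k)).
  rewrite phiS reversedZ reversed_szego; last first.
    have [_ sP _] := monic_opP _ _ muV k.
    by rewrite phiE (leq_trans (size_scale_leq _ _)) ?sP.
  by congr (_ *: _); have := rho_real 1%N; rewrite expr1.
have phi0 : orthonormal_op mu 0 = 1.
  by rewrite phiE monic_op0 expr0 invr1 scale1r.
have phiV (z s : R[i]) (z0 : z != 0) (sz : s ^+ 2 = z) :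
    let x := (z + 1) / (2%:R * rho * s) in
    (orthonormal_op mu n).[z] =
      s ^+ n * ((chebyU _ n).[x] - (1 + alpha^*) / (rho * s) * (chebyU_pred _ n).[x]) /\
    (reversed n (orthonormal_op mu n)).[z] =
      s ^+ n * ((chebyU _ n).[x] - s * (1 + alpha) / rho * (chebyU_pred _ n).[x]).
  apply: (@szego_chebyshev _ alpha alpha^* rho
    (fun k => (orthonormal_op mu k).[z])
    (fun k => (reversed k (orthonormal_op mu k)).[z])) => //.
  - by rewrite rho2 normCKC.
  - by apply: contra_neq z0 => s0; rewrite -sz s0 expr0n.
  - by rewrite phi0 hornerC.
  - by rewrite phi0 reversed0 hornerC.
  - by move=> k; rewrite phiS !hornerE.
  - by move=> k; rewrite revS !hornerE.
(* Both left-hand sides are polynomials in [z], so the identities at nonzero [z] also yield the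
   limits at 0. *)
by split; apply: eq_for_sqrt_poly => z s z0 sz; have [] := phiV z s z0 sz.
Qed.
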